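(* Let $k:\mathbb{D}\times\mathbb{D}\to\mathbb{C}$ be an analytic kernel with $\mathbb{C}[z]\subseteq\mathcal{H}_k$, and let $\{f_n\}_{n\ge 0}\subseteq\mathbb{C}[z]$ be an orthonormal basis of $\mathcal{H}_k$. Assume that the shift $M_z$ on $\mathcal{H}_k$ is left-invertible, $\ker M_z^*=\mathbb{C}f_0$, and $$f_n\in\operatorname{span}\{z^m:m\ge 1\}\qquad(n\ge 1).$$ Then $L_{\tilde M_z}$ and $L_{M_z}$ are similar up to the perturbation of an operator of rank at most one; that is, there exist a bounded invertible operator $X$ and a bounded operator $F$ of rank at most one on $\mathcal{H}_k$ such that $L_{\tilde M_z}X=X(L_{M_z}+F)$.
   Context: $\mathbb{D}$ is the open unit disc. A scalar analytic kernel is a positive definite kernel analytic in the first variable; $\mathcal{H}_k$ is its reproducing kernel Hilbert space of analytic functions on $\mathbb{D}$; the shift $(M_zf)(w)=wf(w)$ is assumed to be bounded on $\mathcal{H}_k$. For a bounded operator $T$ on a Hilbert space: $|T|=(T^*T)^{1/2}$; $T=U|T|$ is the polar decomposition with $U$ the unique partial isometry with $\ker U=\ker T$; the Aluthge transform is $\tilde T=|T|^{1/2}U|T|^{1/2}$. $T$ is left-invertible if $XT=I$ for some bounded $X$ (equivalently $T^*T$ is invertible); then its Shimorin left inverse is $L_T=(T^*T)^{-1}T^*$. If $T$ is left-invertible then so is $\tilde T$, so that $L_{\tilde T}$ is defined. *)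

(* Defs.v *)
From HB Require Import structures.
From mathcomp Require Import all_boot all_order all_algebra.
From mathcomp Require Import complex.
From mathcomp Require Import all_classical all_reals all_analysis.
Set Implicit Arguments.
Unset Strict Implicit.
Unset Printing Implicit Defensive.
Import Order.TTheory GRing.Theory Num.Theory.
Import numFieldNormedType.Exports.
Local Open Scope classical_set_scope.
Local Open Scope ring_scope.
Local Open Scope complex_scope.

(** Complex Hilbert spaces. The inner product is linear in its first argument
    and conjugate-linear in the second. *)
Record hilbertType (R : realType) := HilbertType {
  hilbert_sort :> completeNormedModType R[i];
  hdot : {dot hilbert_sort for Num.conj};
  hdot_norm : forall x : hilbert_sort, `|x| ^+ 2 = hdot x x
}.

Notation "''[' x , y ]" := (@hdot _ _ x y) (format "''[' x ,  y ]") : ring_scope.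

(** Operators are plain functions [H -> H]. Objects determined by a defining
    property (adjoint, square root, polar part, inverse) are selected with
    [xget], whose value is [idfun] when no function has that property. *)
Section operators.
Variables (R : realType) (H : hilbertType R).
Implicit Types T S U : H -> H.

Definition bounded_operator T : Prop :=
  linear T /\ exists M : R[i], forall x, `|T x| <= M * `|x|.

Definition adjoint T : H -> H :=
  xget (idfun : H -> H)
    [set S : H -> H | bounded_operator S /\ forall x y, '[T x, y] = '[x, S y]].

(** Over the complex numbers [0 <= '[T x, x]] includes that the value is real,
    so a positive operator is self-adjoint. *)
Definition positive_operator T : Prop :=
  bounded_operator T /\ forall x, 0 <= '[T x, x].

Definition sqrt_operator T : H -> H :=
  xget (idfun : H -> H) [set S : H -> H | positive_operator S /\ S \o S = T].

Definition abs_operator T : H -> H := sqrt_operator (adjoint T \o T).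

Definition partial_isometry U : Prop :=
  bounded_operator U /\
  forall x, (forall y, U y = 0 -> '[x, y] = 0) -> `|U x| = `|x|.

Definition polar_part T : H -> H :=
  xget (idfun : H -> H)
    [set U : H -> H | [/\ partial_isometry U,
                 forall x, U x = 0 <-> T x = 0
               & T = U \o abs_operator T]].

Definition aluthge T : H -> H :=
  sqrt_operator (abs_operator T) \o polar_part T
    \o sqrt_operator (abs_operator T).

Definition is_inverse T S : Prop := S \o T = idfun /\ T \o S = idfun.

Definition bounded_invertible T : Prop :=
  bounded_operator T /\ exists S, bounded_operator S /\ is_inverse T S.

Definition inverse_operator T : H -> H :=
  xget (idfun : H -> H) [set S : H -> H | bounded_operator S /\ is_inverse T S].

Definition left_invertible T : Prop :=
  exists S, bounded_operator S /\ S \o T = idfun.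

Definition shimorin_left_inverse T : H -> H :=
  inverse_operator (adjoint T \o T) \o adjoint T.

Definition rank_le1 T : Prop :=
  exists v : H, forall x, exists c : R[i], T x = c *: v.

Definition orthonormal_basis (f : nat -> H) : Prop :=
  (forall i j, '[f i, f j] = (i == j)%:R) /\
  closure [set h : H | exists n (c : 'I_n -> R[i]),
                         h = \sum_(i < n) c i *: f i] = setT.

End operators.

Definition disc (R : realType) : Type := {z : R[i] | `|z| < 1}.

(** A function on the disc is analytic when it is the restriction of a function
    on the plane that is complex differentiable at every point of the disc. *)
Definition analytic_on_disc (R : realType) (f : disc R -> R[i]) : Prop :=
  exists2 g : R[i]^o -> R[i]^o,
    (forall w : disc R, derivable g (val w) 1) & forall w, f w = g (val w).

Definition positive_definite_kernel (R : realType)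
    (k : disc R -> disc R -> R[i]) : Prop :=
  forall n (z : 'I_n -> disc R) (c : 'I_n -> R[i]),
    0 <= \sum_(i < n) \sum_(j < n) Num.conj (c i) * c j * k (z i) (z j).

Definition analytic_kernel (R : realType)
    (k : disc R -> disc R -> R[i]) : Prop :=
  positive_definite_kernel k /\
  forall w, analytic_on_disc (fun z => k z w).

(** The reproducing kernel Hilbert space of [k], unique up to the evident
    isomorphism. Its elements are identified with functions on the disc through
    the injective linear map [rk_eval]. *)
Record rkhs (R : realType) (k : disc R -> disc R -> R[i]) := RKHS {
  rk_space :> hilbertType R;
  rk_eval : {linear rk_space -> (disc R -> R[i]^o)};
  rk_eval_inj : injective rk_eval;
  rk_section : disc R -> rk_space;
  rk_sectionE : forall w z, rk_eval (rk_section w) z = k z w;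
  rk_reproducing : forall f w, rk_eval f w = '[f, rk_section w]
}.

Section function_space.
Variables (R : realType) (k : disc R -> disc R -> R[i]) (H : rkhs k).

Definition is_poly_function (h : H) (p : {poly R[i]}) : Prop :=
  forall w, rk_eval H h w = p.[val w].

(** [h] lies in the linear span of the monomials [z ^ m] with [m >= 1]. *)
Definition in_span_monomials_ge1 (h : H) : Prop :=
  exists n (c : 'I_n -> R[i]),
    forall w, rk_eval H h w = \sum_(m < n) c m * val w ^+ m.+1.

(** [Mz] is the shift; boundedness is required separately. *)
Definition is_shift (Mz : H -> H) : Prop :=
  forall f w, rk_eval H (Mz f) w = val w * rk_eval H f w.

End function_space.

(* Main.v *)
Require Import Defs.
From mathcomp Require Import all_boot all_order all_algebra.
From mathcomp Require Import complex.
From mathcomp Require Import all_classical all_reals all_analysis.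
From mathcomp Require Import ring lra.
Set Implicit Arguments.
Unset Strict Implicit.
Unset Printing Implicit Defensive.
Import Order.TTheory GRing.Theory Num.Theory.
Import numFieldNormedType.Exports.
Local Open Scope ring_scope.
Local Open Scope complex_scope.

(** Let [T] be bounded and left-invertible. Then [T^* T] is bounded below, so
    [|T|] and [P := |T|^{1/2}] are positive and invertible. From [T = U |T|] with
    [|T| = P^2], the Aluthge transform [A := P U P] satisfies [A P = P T]: it is
    similar to [T] through [P]. Consequently [P^{-1} L_A P] is a left inverse of
    [T], just as [L_T] is, and the difference [F := P^{-1} L_A P - L_T] vanishes on
    the range of [T]. Every [h] is [T (L_T h)] plus a vector of [ker T^*], because
    [T^* T L_T = T^*]; so when [ker T^*] is spanned by a single vector [e], the
    values of [F] are multiples of [F e], and [L_A P = P (L_T + F)]. This is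
    [shimorin_aluthge_similar], and the shift is a special case.

    The operators involved are characterized by their defining property, so the
    remaining work is to show that they exist. All of this is done for a coercive
    operator [B], one with [c |x|^2 <= Re <B x, x>] for some [c > 0]:

    - [coercive_minimizer] represents a bounded real-linear functional [phi] as
      [v |-> Re <v, B y>], where [y] minimizes [<B x, x> - 2 phi x]. With the
      identity for [B] this is the Riesz representation theorem, which gives the
      adjoint ([adjointP]); for the functionals [Re <., z>] it solves [B y = z],
      which gives the inverse ([coercive_inverse]).
    - [coercive_sqrt] constructs the positive square root. After scaling,
      [A := 1 - t B] is a strict contraction, and [1 - Y] is a square root of
      [1 - A] exactly when [Y = (A + Y^2) / 2]; this equation is solved by
      iteration from [0]. *)

(** * The real part of the inner product *)

Section real_part.
Variables (R : realType) (H : hilbertType R).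
Implicit Types (x y z : H) (t : R).

(** Norms and positive quantities live in [R[i]], which is only partially
    ordered. Estimates are carried out in [R], with the real inner product
    [rdot] and the [R]-valued norm [rnorm]. *)
Definition rdot x y : R := complex.Re '[x, y].
Definition rnorm x : R := complex.Re `|x|.

Lemma complex_ReD (a b : R[i]) : complex.Re (a + b) = complex.Re a + complex.Re b.
Proof. by case: a b => [? ?] [? ?]. Qed.

Lemma complex_ImD (a b : R[i]) : complex.Im (a + b) = complex.Im a + complex.Im b.
Proof. by case: a b => [? ?] [? ?]. Qed.

Lemma complex_ReM (a b : R[i]) :
  complex.Re (a * b) = complex.Re a * complex.Re b - complex.Im a * complex.Im b.
Proof. by case: a b => [? ?] [? ?]. Qed.

Lemma complex_ImM (a b : R[i]) :
  complex.Im (a * b) = complex.Re a * complex.Im b + complex.Im a * complex.Re b.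
Proof. by case: a b => [? ?] [? ?]. Qed.

Lemma complex_conjE (a : R[i]) : Num.conj a = (complex.Re a) -i* (complex.Im a).
Proof. by case: a. Qed.

Lemma dotC x y : '[x, y] = Num.conj '[y, x].
Proof. by rewrite (hermC (hdot H)) expr0 mul1r. Qed.

Lemma rdotC x y : rdot x y = rdot y x.
Proof. by rewrite /rdot dotC complex_conjE. Qed.

Lemma rdotDl x y z : rdot (x + y) z = rdot x z + rdot y z.
Proof. by rewrite /rdot linearDl complex_ReD. Qed.

Lemma rdotDr x y z : rdot z (x + y) = rdot z x + rdot z y.
Proof. by rewrite rdotC rdotDl !(rdotC z). Qed.

Lemma rdotZl t x y : rdot (t%:C *: x) y = t * rdot x y.
Proof. by rewrite /rdot linearZl_LR complex_ReM /= mul0r subr0. Qed.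

Lemma rdotZr t x y : rdot x (t%:C *: y) = t * rdot x y.
Proof. by rewrite rdotC rdotZl rdotC. Qed.

Lemma rdotil x y : rdot ('i *: x) y = - complex.Im '[x, y].
Proof. by rewrite /rdot linearZl_LR complex_ReM /= mul0r sub0r mul1r. Qed.

Lemma rdotNl x y : rdot (- x) y = - rdot x y.
Proof. by rewrite -scaleN1r -(rmorphN1 (real_complex R)) rdotZl mulN1r. Qed.

Lemma rdotNr x y : rdot x (- y) = - rdot x y.
Proof. by rewrite rdotC rdotNl rdotC. Qed.

Lemma rdotBl x y z : rdot (x - y) z = rdot x z - rdot y z.
Proof. by rewrite rdotDl rdotNl. Qed.

Lemma rdotBr x y z : rdot z (x - y) = rdot z x - rdot z y.
Proof. by rewrite rdotDr rdotNr. Qed.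

Lemma normE x : `|x| = (rnorm x)%:C.
Proof. by rewrite /rnorm RRe_real // ger0_real. Qed.

Lemma rnorm_ge0 x : 0 <= rnorm x.
Proof. by rewrite -ler0c -normE. Qed.

Lemma rnorm_sqr x : rnorm x ^+ 2 = rdot x x.
Proof. by rewrite /rdot -hdot_norm normE expr2 /= mulr0 subr0. Qed.

Lemma rnorm_eq0 x : rnorm x = 0 -> x = 0.
Proof. by move=> x0; apply/eqP; rewrite -normr_eq0 normE x0. Qed.

Lemma rnorm0 : rnorm (0 : H) = 0.
Proof. by rewrite /rnorm normr0. Qed.

Lemma rnormN x : rnorm (- x) = rnorm x.
Proof. by rewrite /rnorm normrN. Qed.

Lemma rnormBC x y : rnorm (x - y) = rnorm (y - x).
Proof. by rewrite /rnorm distrC. Qed.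

Lemma ler_rnormD x y : rnorm (x + y) <= rnorm x + rnorm y.
Proof. by have := ler_normD x y; rewrite !normE lecE /= => /andP[]. Qed.

Lemma ler_rnormB x y : rnorm (x - y) <= rnorm x + rnorm y.
Proof. by rewrite -(rnormN y) ler_rnormD. Qed.

Lemma rnormZ (a : R[i]) x : rnorm (a *: x) = complex.Re `|a| * rnorm x.
Proof.
rewrite {1}/rnorm normrZ normE.
by case: `|a| => b c /=; rewrite mulr0 subr0.
Qed.

Lemma rnormZr t x : 0 <= t -> rnorm (t%:C *: x) = t * rnorm x.
Proof. by move=> t0; rewrite rnormZ ger0_norm ?ler0c. Qed.

(** Cauchy-Schwarz: expand the square of the norm of [|y| x - |x| y], which is
    [2 |x| |y| (|x| |y| - Re <x, y>)]. *)
Lemma rdot_le x y : rdot x y <= rnorm x * rnorm y.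
Proof.
have [x0|x0] := eqVneq (rnorm x) 0.
  by rewrite (rnorm_eq0 x0) rnorm0 mul0r /rdot linear0l.
have [y0|y0] := eqVneq (rnorm y) 0.
  by rewrite (rnorm_eq0 y0) rnorm0 mulr0 /rdot linear0r.
have xy : 0 < rnorm x * rnorm y by rewrite mulr_gt0 // lt_def ?x0 ?y0 rnorm_ge0.
have := sqr_ge0 (rnorm ((rnorm y)%:C *: x - (rnorm x)%:C *: y)).
rewrite rnorm_sqr rdotBl !rdotBr !rdotZl !rdotZr -!rnorm_sqr (rdotC y x).
move: xy; set a := rnorm x; set b := rnorm y; set d := rdot x y => xy h.
by rewrite -(ler_pM2l xy) -subr_ge0; move: h; nra.
Qed.

Lemma rdot_norm_le x y : `|rdot x y| <= rnorm x * rnorm y.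
Proof.
by rewrite ler_norml rdot_le andbT lerNl -rdotNl (le_trans (rdot_le _ _)) ?rnormN.
Qed.

Lemma rdot_inj x y : (forall z, rdot z x = rdot z y) -> x = y.
Proof.
move=> h; apply/eqP; rewrite -subr_eq0; apply/eqP/rnorm_eq0/eqP.
by rewrite -sqrf_eq0 rnorm_sqr rdotBr h subrr.
Qed.

(** The complex inner product is recovered from [rdot], so identities between
    values of [rdot] that are stable under [x |-> 'i *: x] lift to [hdot]. *)
Lemma dot_rdot x y : '[x, y] = (rdot x y) -i* (rdot ('i *: x) y).
Proof. by rewrite rdotil opprK /rdot; case: '[x, y]. Qed.

Local Open Scope classical_set_scope.
Local Open Scope ring_scope.

(** Completeness with an explicit rate: the limit inherits the rate [e] of the
    Cauchy condition. *)
Lemma cauchy_limit (u : nat -> H) (e : nat -> R) :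
  (forall d : R, 0 < d -> exists n, e n <= d) ->
  (forall n m, (n <= m)%N -> rnorm (u m - u n) <= e n) ->
  exists l, forall n, rnorm (u n - l) <= e n.
Proof.
move=> e0 ue.
have cu : cauchy (u @ \oo).
  apply/cauchy_ballP => d d0.
  have dE : d = (complex.Re d)%:C by rewrite RRe_real ?gtr0_real.
  have rd : 0 < complex.Re d by move: d0; rewrite ltcE => /andP[].
  have [n en] := e0 (complex.Re d / 3) ltac:(lra).
  exists (u @` [set m | (n <= m)%N], u @` [set m | (n <= m)%N]).
    by split; exists n => // m nm; exists m.
  move=> [_ _] [/= [a na <-] [b nb <-]].
  rewrite -ball_normE /= dE normE ltcR -(subrK (u n) (u a)) -addrA.
  rewrite (le_lt_trans (ler_rnormD _ _)) // (rnormBC (u n)).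
  rewrite (le_lt_trans (lerD (ue _ _ na) (ue _ _ nb))) //.
  by lra.
have /cvg_ex[l ul] : cvg (u @ \oo) by apply: cauchy_cvg.
exists l => n; apply/ler_addgt0Pr => d d0.
have dC : 0 < d%:C :> R[i] by rewrite ltcR.
have [N _ NP] := (@cvgrPdist_lt _ _ _ _ _ _ _).1 ul _ dC.
have := NP (maxn N n) (leq_maxl _ _); rewrite /= normE ltcR => lN.
rewrite rnormBC -(subrK (u (maxn N n)) l) -addrA.
rewrite (le_trans (ler_rnormD _ _)) // (addrC (e n)).
by rewrite lerD ?ue ?leq_maxr ?(ltW lN).
Qed.

End real_part.

(** * Bounded, symmetric and positive operators *)

Section operators.
Variables (R : realType) (H : hilbertType R).
Implicit Types (x y z : H) (t : R) (B S T : H -> H).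

Lemma op0 T : linear T -> T 0 = 0.
Proof. by move=> lT; have := lT (-1) 0 0; rewrite scaler0 addr0 scaleN1r addNr. Qed.

Lemma opD T x y : linear T -> T (x + y) = T x + T y.
Proof. by move=> lT; have := lT 1 x y; rewrite !scale1r. Qed.

Lemma opZ T a x : linear T -> T (a *: x) = a *: T x.
Proof. by move=> lT; have := lT a x 0; rewrite (op0 lT) !addr0. Qed.

Lemma opB T x y : linear T -> T (x - y) = T x - T y.
Proof. by move=> lT; rewrite (opD _ _ lT) -scaleN1r (opZ _ _ lT) scaleN1r. Qed.

Lemma linear_comp S T : linear S -> linear T -> linear (S \o T).
Proof. by move=> lS lT a x y /=; rewrite lT lS. Qed.

Lemma bounded_operatorI T (M : R) :
  linear T -> (forall x, rnorm (T x) <= M * rnorm x) -> bounded_operator T.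
Proof.
by move=> lT TM; split=> //; exists M%:C => x; rewrite !normE -rmorphM lecR.
Qed.

(** The bound in [bounded_operator] is an arbitrary complex number, with no sign
    prescribed when the space is trivial; a positive real one always exists. *)
Lemma bounded_operatorE T : bounded_operator T ->
  exists2 M : R, 0 < M & forall x, rnorm (T x) <= M * rnorm x.
Proof.
move=> [_ [M TM]]; exists (`|complex.Re M| + 1) => [|x].
  by rewrite ltr_wpDl.
have := TM x; rewrite lecE !normE complex_ReM /= mulr0 subr0 => /andP[_] /le_trans; apply.
by rewrite ler_wpM2r ?rnorm_ge0 // ler_wpDr ?ler_norm.
Qed.

Lemma bounded_operator_comp S T :
  bounded_operator S -> bounded_operator T -> bounded_operator (S \o T).
Proof.
move=> bS bT.
have [M M0 SM] := bounded_operatorE bS; have [N N0 TN] := bounded_operatorE bT.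
apply: (@bounded_operatorI _ (M * N)) => [|x].
  by apply: linear_comp; [case: bS | case: bT].
by rewrite (le_trans (SM _)) // -mulrA ler_wpM2l // ltW.
Qed.

Lemma bounded_operator_sub S T :
  bounded_operator S -> bounded_operator T ->
  bounded_operator (fun x => S x - T x).
Proof.
move=> bS bT.
have [M M0 SM] := bounded_operatorE bS; have [N N0 TN] := bounded_operatorE bT.
apply: (@bounded_operatorI _ (M + N)) => [a x y|x].
  case: bS bT => lS _ [lT _].
  by rewrite lS lT scalerBr opprD addrACA.
by rewrite (le_trans (ler_rnormB _ _)) // mulrDl lerD.
Qed.

Definition rsymmetric T := forall x y, rdot (T x) y = rdot x (T y).

Lemma rsymmetric_dot T : linear T -> rsymmetric T ->
  forall x y, '[T x, y] = '[x, T y].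
Proof.
move=> lT sT x y.
by rewrite !dot_rdot sT -(opZ _ _ lT) sT.
Qed.

Lemma positive_operatorI T : bounded_operator T -> rsymmetric T ->
  (forall x, 0 <= rdot (T x) x) -> positive_operator T.
Proof.
move=> bT sT T0; split=> // x; rewrite lecE /= T0 andbT.
have [lT _] := bT; have := rsymmetric_dot lT sT x x.
rewrite [X in _ = X]dotC complex_conjE => /(congr1 (@complex.Im R)) /= ?.
by apply/eqP; lra.
Qed.

Lemma positive_operator_ge0 T x : positive_operator T -> 0 <= rdot (T x) x.
Proof. by move=> [_ /(_ x)]; rewrite lecE => /andP[]. Qed.

(** Polarization: the form [<T x, y>] is real on the diagonal, so it is
    Hermitian. *)
Lemma positive_operator_sym T : positive_operator T -> rsymmetric T.
Proof.
move=> [[lT _] T0].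
have I0 z : complex.Im '[T z, z] = 0.
  by have := T0 z; rewrite lecE => /andP[/eqP].
have h x y : complex.Im '[T x, y] + complex.Im '[T y, x] = 0.
  have := I0 (x + y); rewrite (opD _ _ lT) linearDl !linearDr !complex_ImD !I0 /=; lra.
move=> x y; rewrite (rdotC x).
have := h ('i *: x) y; rewrite (opZ _ _ lT).
have -> : complex.Im '['i *: T x, y] = rdot (T x) y.
  by rewrite linearZl_LR complex_ImM /= mul0r mul1r add0r.
have -> : complex.Im '[T y, 'i *: x] = - rdot (T y) x.
  by rewrite linearZr_LR complex_ImM complex_conjE /= mul0r mulN1r add0r.
lra.
Qed.

End operators.

(** * Geometric rates *)

Section geometric.
Local Open Scope classical_set_scope.
Local Open Scope ring_scope.

Lemma geometric_small (R : realType) (q K : R) : 0 <= q < 1 ->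
  forall d : R, 0 < d -> exists n, K * q ^+ n <= d.
Proof.
move=> /andP[q0 q1] d d0.
have qn0 : (fun n => q ^+ n) @ \oo --> 0.
  by apply: cvg_expr; rewrite ger0_norm.
have d'0 : 0 < d / (`|K| + 1) by rewrite divr_gt0 // ltr_wpDl.
have [N _ NP] := (@cvgrPdist_le _ _ _ _ _ _ _).1 qn0 _ d'0.
exists N; have := NP N (leqnn N).
rewrite /= sub0r normrN ger0_norm ?exprn_ge0 // ler_pdivlMr ?ltr_wpDl // => le_d.
apply: le_trans le_d; rewrite mulrC ler_wpM2l ?exprn_ge0 //.
by rewrite ler_wpDr ?ler_norm.
Qed.

Lemma geometric_le0 (R : realType) (q K a : R) : 0 <= q < 1 ->
  (forall n, a <= K * q ^+ n) -> a <= 0.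
Proof.
move=> q01 aK; apply/ler_addgt0Pr => d d0; rewrite add0r.
by have [n nd] := geometric_small K q01 d0; exact: le_trans nd.
Qed.

End geometric.

(** * Representation of functionals by coercive operators *)

Section representation.
Variables (R : realType) (H : hilbertType R).
Implicit Types (x y z : H) (t : R) (B S T : H -> H).

Definition coercive B :=
  positive_operator B /\
  exists2 c : R, 0 < c & forall x, c * rnorm x ^+ 2 <= rdot (B x) x.

Section minimization.
Variables (B : H -> H) (c : R) (phi : H -> R) (M : R).
Hypothesis posB : positive_operator B.
Hypothesis c_gt0 : 0 < c.
Hypothesis cB : forall x, c * rnorm x ^+ 2 <= rdot (B x) x.
Hypothesis phiD : forall x y, phi (x + y) = phi x + phi y.
Hypothesis phiZ : forall t x, phi (t%:C *: x) = t * phi x.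
Hypothesis phiM : forall x, `|phi x| <= M * rnorm x.

(** The unique critical point of [energy] is the [y] with [phi = Re <., B y>]. *)
Let energy x := rdot (B x) x - 2 * phi x.

Let linB : linear B.
Proof. by case: posB => [[]]. Qed.

Let symB : rsymmetric B.
Proof. exact: positive_operator_sym. Qed.

(** Completing the square in [c |x|^2 - 2 M |x|]. *)
Let energy_lb x : - (M ^+ 2 / c) <= energy x.
Proof.
have := cB x; have := phiM x; have := sqr_ge0 (c * rnorm x - M).
rewrite ler_norml /energy => sq /andP[_ le1] le2.
rewrite -(ler_pM2l c_gt0) mulrN mulrCA divff ?gt_eqF // mulr1.
have : c * (c * rnorm x ^+ 2 - 2 * (M * rnorm x)) <=
       c * (rdot (B x) x - 2 * phi x) by rewrite ler_pM2l //; lra.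
by lra.
Qed.

Let energy_step x t v : energy (x + t%:C *: v) =
  energy x + 2 * t * (rdot (B x) v - phi v) + t ^+ 2 * rdot (B v) v.
Proof.
rewrite /energy (opD _ _ linB) (opZ _ _ linB) phiD phiZ !(rdotDl, rdotDr).
rewrite !(rdotZl, rdotZr) (symB v x) (rdotC v); ring.
Qed.

(** The parallelogram identity for the form [<B x, x>]: two points of nearly
    minimal energy are close, since their midpoint cannot do better than the
    infimum. *)
Let energy_mid x y : energy x + energy y =
  2 * energy ((1 / 2)%:C *: (x + y)) + rdot (B (x - y)) (x - y) / 2.
Proof.
rewrite /energy (opZ _ _ linB) (opD _ _ linB) (opB _ _ linB) phiZ phiD.
rewrite !(rdotZl, rdotZr, rdotDl, rdotDr, rdotNl, rdotNr).
by rewrite (symB y x) (rdotC y); field.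
Qed.

(** A minimizing sequence is Cauchy by [energy_mid], and its limit is a critical
    point. *)
Lemma coercive_minimizer : exists y, forall v, phi v = rdot v (B y).
Proof.
pose E := range energy.
have lbE : has_lbound E by exists (- (M ^+ 2 / c)) => _ [x _ <-].
have infE : has_inf E by split=> //; exists (energy 0); exists 0.
have minE x : inf E <= energy x by apply: ge_inf => //; exists x.
pose q : R := 1 / 2.
have q01 : 0 <= q < 1 by rewrite /q; lra.
have q_gt0 : 0 < q by rewrite /q; lra.
(* The excess [c / 4 * (q ^+ n) ^+ 2] makes the distances at most [q ^+ n]. *)
have /choice[u uP] n : exists x, energy x < inf E + c / 4 * (q ^+ n) ^+ 2.
  have e0 : 0 < c / 4 * (q ^+ n) ^+ 2.
    by rewrite mulr_gt0 ?divr_gt0 // ?exprn_gt0.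
  by have [_ [x _ <-] xP] := inf_adherent e0 infE; exists x.
have [n m nm|y yP] := @cauchy_limit _ H u (fun n => 1 * q ^+ n) (geometric_small 1 q01).
  rewrite mul1r -(@ler_pXn2r _ 2) ?nnegrE ?rnorm_ge0 ?exprn_ge0 ?(ltW q_gt0) //.
  have qmn : (q ^+ m) ^+ 2 <= (q ^+ n) ^+ 2.
    rewrite ler_pXn2r ?nnegrE ?exprn_ge0 ?(ltW q_gt0) //.
    by apply: ler_wiXn2l => //; rewrite /q; lra.
  rewrite -(ler_pM2l c_gt0) (le_trans (cB _)) //.
  have := energy_mid (u m) (u n); have := minE ((1 / 2)%:C *: (u m + u n)).
  have := uP m; have := uP n.
  have : c * (q ^+ m) ^+ 2 <= c * (q ^+ n) ^+ 2 by rewrite ler_pM2l.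
  by lra.
have {}yP n : rnorm (u n - y) <= q ^+ n by have := yP n; rewrite mul1r.
exists y => v; rewrite rdotC.
pose K := c / 8 + rdot (B v) v / 2.
(* The derivative of the energy at [u n] is small: a step of length [q ^+ n] in
   the direction of [v] or [- v] cannot go below the infimum. *)
have dK n : `|rdot (B (u n)) v - phi v| <= K * q ^+ n.
  have qn0 : 0 < q ^+ n by rewrite exprn_gt0.
  rewrite -(ler_pM2l qn0) /K.
  have := minE (u n + (- q ^+ n)%:C *: v); have := minE (u n + (q ^+ n)%:C *: v).
  rewrite !energy_step; have := uP n.
  set d := rdot (B (u n)) v - phi v; set p := q ^+ n; set a := rdot (B v) v.
  by case: (ger0P d) => _; lra.
apply/eqP; rewrite eq_sym -subr_eq0 -normr_le0.
apply: (@geometric_le0 _ q (K + rnorm (B v))) => // n.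
have -> : rdot (B y) v - phi v =
  (rdot (B (u n)) v - phi v) - rdot (u n - y) (B v).
  by rewrite -symB (opB _ _ linB) rdotBl; ring.
rewrite (le_trans (ler_normB _ _)) // mulrDl lerD //.
by rewrite (le_trans (rdot_norm_le _ _)) // mulrC ler_wpM2l ?rnorm_ge0.
Qed.

End minimization.

Lemma coercive_id : coercive (idfun : H -> H).
Proof.
split; last by exists 1 => // x; rewrite mul1r rnorm_sqr.
apply: positive_operatorI => // [|x /=]; last by rewrite -rnorm_sqr sqr_ge0.
by apply: (@bounded_operatorI _ _ _ 1) => // x; rewrite mul1r.
Qed.

(** Riesz representation of [x |-> Re <T x, y>] gives the value of the adjoint
    at [y]. *)
Lemma adjointP T : bounded_operator T ->
  bounded_operator (adjoint T) /\ forall x y, '[T x, y] = '[x, adjoint T y].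
Proof.
move=> bT; rewrite /adjoint; case: xgetP => [S _ //|noS]; exfalso.
have [lT _] := bT; have [M M0 TM] := bounded_operatorE bT.
have [posI [c c0 cI]] := coercive_id.
have /choice[S SP] y : exists z, forall x, rdot (T x) y = rdot x z.
  have := coercive_minimizer posI c0 cI (phi := fun x => rdot (T x) y)
    (M := M * rnorm y); apply=> [x z|t x|x].
  - by rewrite (opD _ _ lT) rdotDl.
  - by rewrite (opZ _ _ lT) rdotZl.
  - rewrite (le_trans (rdot_norm_le _ _)) // mulrAC ler_wpM2r ?rnorm_ge0 //.
have dotS x y : '[T x, y] = '[x, S y].
  by rewrite !dot_rdot -(opZ _ _ lT) !SP.
apply: (noS S); split=> //; apply: (@bounded_operatorI _ _ _ M) => [a x y|x].
  apply: rdot_inj => z.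
  by rewrite /rdot linearDr linearZr_LR /= -!dotS linearDr linearZr_LR.
have [->|Sx0] := eqVneq (rnorm (S x)) 0.
  by rewrite mulr_ge0 ?rnorm_ge0 // ltW.
have Sx_gt0 : 0 < rnorm (S x) by rewrite lt_def Sx0 rnorm_ge0.
rewrite -(ler_pM2l Sx_gt0) -expr2 rnorm_sqr -SP (le_trans (rdot_le _ _)) //.
by rewrite mulrA ler_wpM2r ?rnorm_ge0 // mulrC.
Qed.

(** Surjectivity comes from the representation of [Re <., z>]; coercivity gives
    injectivity and bounds the inverse by [c^-1]. *)
Lemma coercive_inverse B : coercive B -> bounded_operator (inverse_operator B) /\
  is_inverse B (inverse_operator B).
Proof.
move=> [posB [c c0 cB]]; rewrite /inverse_operator.
case: xgetP => [S _ //|noS]; exfalso.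
have [[lB _] _] := posB.
have lowB x : c * rnorm x <= rnorm (B x).
  have [->|x0] := eqVneq (rnorm x) 0; first by rewrite mulr0 rnorm_ge0.
  have x_gt0 : 0 < rnorm x by rewrite lt_def x0 rnorm_ge0.
  rewrite -(ler_pM2r x_gt0) -mulrA -expr2 (le_trans (cB x)) //.
  exact: rdot_le.
have injB : injective B.
  move=> x y Bxy; apply/eqP; rewrite -subr_eq0; apply/eqP/rnorm_eq0/eqP.
  rewrite eq_le rnorm_ge0 andbT -(pmulr_rle0 _ c0) (le_trans (lowB _)) //.
  by rewrite (opB _ _ lB) Bxy subrr rnorm0.
have /choice[S SP] z : exists y, B y = z.
  have [|t x|x|y yP] := coercive_minimizer posB c0 cB (phi := fun x => rdot x z)
    (M := rnorm z).
  - by move=> x y; rewrite rdotDl.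
  - by rewrite rdotZl.
  - by rewrite mulrC rdot_norm_le.
  - by exists y; apply: rdot_inj => x; rewrite -yP.
apply: (noS S); split; last first.
  by split; apply/funext => x /=; [apply: injB; rewrite SP | rewrite SP].
apply: (@bounded_operatorI _ _ _ c^-1) => [a x y|x].
  by apply: injB; rewrite lB !SP.
by rewrite ler_pdivlMl // (le_trans (lowB _)) // SP.
Qed.

End representation.

(** * Square roots of coercive operators *)

Section square_root.
Variables (R : realType) (H : hilbertType R).
Implicit Types (x y z : H) (t : R) (B S T A : H -> H).

(** Iterates of [Y |-> (A + Y^2) / 2], whose fixed points satisfy
    [(1 - Y)^2 = 1 - A]. *)
Fixpoint sqrt_iter A n : H -> H :=
  if n is n'.+1 then
    fun x => (1 / 2 : R)%:C *: (A x + sqrt_iter A n' (sqrt_iter A n' x))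
  else fun=> 0.

Lemma sqrt_iter_linear A n : linear A -> linear (sqrt_iter A n).
Proof.
move=> lA; elim: n => [|n IH] a x y /=; first by rewrite scaler0 addr0.
rewrite lA !IH scalerA (mulrC a) -scalerA -scalerDr.
by congr (_ *: _); rewrite scalerDr addrACA.
Qed.

Lemma sqrt_iter_sym A n : rsymmetric A -> rsymmetric (sqrt_iter A n).
Proof.
move=> sA; elim: n => [|n IH] x y /=; first by rewrite rdotC /rdot !linear0r.
by rewrite rdotZl rdotZr rdotDl rdotDr sA !IH.
Qed.

Section contraction.
Variables (A : H -> H) (q : R).
Hypothesis linA : linear A.
Hypothesis q01 : 0 <= q < 1.
Hypothesis qA : forall x, rnorm (A x) <= q * rnorm x.

Let q_ge0 : 0 <= q. Proof. by case/andP: q01. Qed.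
Let q_lt1 : q < 1. Proof. by case/andP: q01. Qed.

Let rnorm_half x : rnorm ((1 / 2 : R)%:C *: x) = rnorm x / 2.
Proof. by rewrite rnormZr ?divr_ge0 // mul1r mulrC. Qed.

(** The ball of radius [q] is stable because [(q + q^2) / 2 <= q]. *)
Lemma sqrt_iter_le n x : rnorm (sqrt_iter A n x) <= q * rnorm x.
Proof.
elim: n x => [|n IH] x /=; first by rewrite rnorm0 mulr_ge0 ?rnorm_ge0.
rewrite rnorm_half ler_pdivrMr // (le_trans (ler_rnormD _ _)) //.
have := qA x; have := le_trans (IH _) (ler_wpM2l q_ge0 (IH x)).
have : q * (q * rnorm x) <= 1 * (q * rnorm x).
  by rewrite ler_wpM2r ?mulr_ge0 ?rnorm_ge0 // ltW.
by lra.
Qed.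

(** On the ball of radius [q] the map [Y |-> (A + Y^2) / 2] contracts by [q],
    by the identity [Y'^2 - Y^2 = Y' (Y' - Y) + (Y' - Y) Y], in which [Y] and [Y']
    need not commute. *)
Lemma sqrt_iter_step n x :
  rnorm (sqrt_iter A n.+1 x - sqrt_iter A n x) <= q ^+ n.+1 * rnorm x.
Proof.
elim: n x => [|n IH] x.
  by rewrite subr0 expr1; exact: (sqrt_iter_le 1).
rewrite [sqrt_iter A n.+2]/= [X in _ - X]/= -scalerBr rnorm_half.
set S := sqrt_iter A n; set S' := sqrt_iter A n.+1.
have lS' : linear S' by exact: sqrt_iter_linear.
have -> : A x + S' (S' x) - (A x + S (S x)) = S' (S' x - S x) + (S' (S x) - S (S x)).
  by rewrite (opB _ _ lS') addrA subrK opprD addrACA subrr add0r.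
rewrite ler_pdivrMr // (le_trans (ler_rnormD _ _)) //.
have := le_trans (sqrt_iter_le n.+1 _) (ler_wpM2l q_ge0 (IH x)).
have := le_trans (IH (S x)) (ler_wpM2l (exprn_ge0 n.+1 q_ge0) (sqrt_iter_le n x)).
rewrite -/S' -/S (exprS _ n.+1); lra.
Qed.

(** The sum of the geometric series bounding all the steps, at the vector [x]. *)
Let tail x := q * rnorm x / (1 - q).

Lemma sqrt_iter_cauchy n m x : (n <= m)%N ->
  rnorm (sqrt_iter A m x - sqrt_iter A n x) <= tail x * q ^+ n.
Proof.
have q1 : 0 < 1 - q by rewrite subr_gt0.
move=> /subnKC <-; set k := (m - n)%N.
suff : rnorm (sqrt_iter A (n + k) x - sqrt_iter A n x)
       <= tail x * (q ^+ n - q ^+ (n + k)).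
  move/le_trans; apply; rewrite ler_wpM2l //.
    by rewrite divr_ge0 ?mulr_ge0 ?rnorm_ge0 // ltW.
  by rewrite lerBlDr lerDl exprn_ge0.
elim: k => [|k IH]; first by rewrite addn0 !subrr rnorm0 mulr0.
rewrite addnS -[X in X - _](subrK (sqrt_iter A (n + k) x)) -addrA.
rewrite (le_trans (ler_rnormD _ _)) // (le_trans (lerD (sqrt_iter_step _ _) IH)) //.
rewrite /tail exprS le_eqVlt; apply/orP; left; apply/eqP.
by field; rewrite gt_eqF.
Qed.

Lemma sqrt_iter_limit : exists Y : H -> H, exists K : H -> R,
  forall x n, rnorm (sqrt_iter A n x - Y x) <= K x * q ^+ n.
Proof.
have /choice[Y YP] x : exists y, forall n,
    rnorm (sqrt_iter A n x - y) <= tail x * q ^+ n.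
  apply: (cauchy_limit (geometric_small (tail x) q01)) => n m.
  exact: sqrt_iter_cauchy.
by exists Y, tail.
Qed.

(** Every property of the pointwise limit is an equality or inequality whose
    defect is at most a multiple of [q ^+ n] for all [n]. *)
Lemma sqrt_fixpoint : rsymmetric A -> exists Y : H -> H,
  [/\ linear Y, rsymmetric Y, forall x, rnorm (Y x) <= q * rnorm x
    & forall x, Y x = (1 / 2 : R)%:C *: (A x + Y (Y x))].
Proof.
move=> symA; have [Y [K YP]] := sqrt_iter_limit.
pose S := sqrt_iter A.
have lS n : linear (S n) := sqrt_iter_linear n linA.
have rnorm_le0 (x : H) : rnorm x <= 0 -> x = 0.
  by move=> x0; apply/rnorm_eq0/eqP; rewrite eq_le x0 rnorm_ge0.
have YP' x n : rnorm (Y x - S n x) <= K x * q ^+ n by rewrite rnormBC.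
exists Y; split.
- move=> a x y; apply/subr0_eq/rnorm_le0.
  apply: (@geometric_le0 _ q (K (a *: x + y) + (complex.Re `|a| * K x + K y))) => // n.
  have -> : Y (a *: x + y) - (a *: Y x + Y y) = (Y (a *: x + y) - S n (a *: x + y))
      + (a *: (S n x - Y x) + (S n y - Y y)).
    by rewrite (lS n) scalerBr [X in _ = _ + X]addrACA -opprD addrA subrK.
  rewrite !mulrDl (le_trans (ler_rnormD _ _)) // lerD //.
  rewrite (le_trans (ler_rnormD _ _)) // lerD // rnormZ -mulrA ler_wpM2l //.
  by rewrite -ler0c RRe_real ?ger0_real.
- move=> x y; apply/subr0_eq/eqP; rewrite -normr_le0.
  apply: (@geometric_le0 _ q (K x * rnorm y + K y * rnorm x)) => // n.
  have -> : rdot (Y x) y - rdot x (Y y) =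
      rdot (Y x - S n x) y + rdot (S n y - Y y) x.
    by rewrite !rdotBl (sqrt_iter_sym n symA x y) !(rdotC _ x); ring.
  rewrite (le_trans (ler_normD _ _)) // mulrDl !(mulrAC _ _ (q ^+ n)).
  by rewrite lerD // (le_trans (rdot_norm_le _ _)) // ler_wpM2r ?rnorm_ge0.
- move=> x; rewrite -subr_le0; apply: (@geometric_le0 _ q (K x)) => // n.
  rewrite lerBlDr -[Y x](subrK (S n x)) (le_trans (ler_rnormD _ _)) //.
  by rewrite lerD // sqrt_iter_le.
- move=> x; apply/subr0_eq/rnorm_le0.
  apply: (@geometric_le0 _ q (q * K x + (q * K x + K (Y x)) / 2)) => // n.
  have -> : Y x - (1 / 2 : R)%:C *: (A x + Y (Y x)) = (Y x - S n.+1 x)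
     + (1 / 2 : R)%:C *: (S n (S n x - Y x) + (S n (Y x) - Y (Y x))).
    rewrite (opB _ _ (lS n)) (addrA (_ - _)) subrK.
    rewrite [S n.+1 x]/= -addrA; congr (_ + _).
    rewrite -!scalerN -scalerDr; congr (_ *: _).
    by rewrite !opprD addrA subrK.
  rewrite (le_trans (ler_rnormD _ _)) // mulrDl lerD //.
    by rewrite (le_trans (YP' _ _)) // exprS mulrCA mulrA.
  rewrite rnorm_half mulrAC ler_pM2r // (le_trans (ler_rnormD _ _)) // mulrDl lerD //.
  by rewrite (le_trans (sqrt_iter_le _ _)) // -mulrA ler_wpM2l.
Qed.

End contraction.

(** For [t := c / M^2] one has
    [|x - t B x|^2 = |x|^2 - 2 t <B x, x> + t^2 |B x|^2 <= (1 - c^2 / M^2) |x|^2],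
    so [A := 1 - t B] is a strict contraction. The fixed point [Y] for [A] gives
    [(1 - Y)^2 = t B], and [1 - Y] is positive because [Y] is a contraction. *)
Lemma coercive_sqrt B : coercive B ->
  exists S, positive_operator S /\ S \o S = B.
Proof.
move=> [posB [c c0 cB]]; have [bB _] := posB.
have [lB _] := bB; have symB := positive_operator_sym posB.
have [M' M'0 M'B] := bounded_operatorE bB.
(* Enlarging the bound of [B] ensures that [c / M < 1]. *)
pose M := M' + c; have M0 : 0 < M by rewrite addr_gt0.
have MB x : rnorm (B x) <= M * rnorm x.
  by rewrite (le_trans (M'B x)) // ler_wpM2r ?rnorm_ge0 // lerDl ltW.
pose r := c / M.
have r01 : 0 < r < 1.
  by rewrite divr_gt0 //= ltr_pdivrMr // mul1r /M ltrDr.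
pose t := r / M; have t0 : 0 < t by rewrite divr_gt0 //; case/andP: r01.
pose q := Num.sqrt (1 - r ^+ 2).
have q2 : 0 <= 1 - r ^+ 2 by nra.
have q01 : 0 <= q < 1.
  by rewrite sqrtr_ge0 /= -[ltRHS]sqrtr1 ltr_sqrt //; nra.
pose A x := x - t%:C *: B x.
have lA : linear A.
  move=> a x y; rewrite /A lB scalerDr scalerA (mulrC _ a) -scalerA scalerBr opprD.
  by rewrite addrACA.
have symA : rsymmetric A.
  by move=> x y; rewrite /A rdotBl rdotBr rdotZl rdotZr symB.
have qA x : rnorm (A x) <= q * rnorm x.
  rewrite -(@ler_pXn2r _ 2) ?nnegrE ?mulr_ge0 ?rnorm_ge0 ?sqrtr_ge0 //.
  rewrite exprMn sqr_sqrtr // rnorm_sqr /A rdotBl !rdotBr !rdotZl !rdotZr.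
  rewrite (rdotC x) -!rnorm_sqr.
  have : rnorm (B x) ^+ 2 <= (M * rnorm x) ^+ 2.
    by rewrite ler_pXn2r ?nnegrE ?mulr_ge0 ?rnorm_ge0 // ltW.
  rewrite exprMn; set n := rnorm x ^+ 2; set b := rnorm (B x) ^+ 2 => bM.
  have cn := cB x; rewrite -/n in cn; set d := rdot (B x) x in cn *.
  have tc : t * (c * n) <= t * d by rewrite ler_pM2l.
  have tb : t ^+ 2 * b <= t ^+ 2 * (M ^+ 2 * n) by rewrite ler_pM2l ?exprn_gt0.
  have e1 : t * c = r ^+ 2 by rewrite /t /r; field; rewrite gt_eqF.
  have e2 : t ^+ 2 * M ^+ 2 = r ^+ 2 by rewrite /t; field; rewrite gt_eqF.
  by rewrite mulrA e1 in tc; rewrite mulrA e2 in tb; lra.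
have [Y [lY symY qY YE]] := sqrt_fixpoint lA q01 qA symA.
pose s := Num.sqrt t^-1.
have s0 : 0 <= s by exact: sqrtr_ge0.
exists (fun x => s%:C *: (x - Y x)); split.
  apply: positive_operatorI => [|x y|x].
  - apply: (@bounded_operatorI _ _ _ (s * 2)) => [a x y|x].
      rewrite lY scalerA (mulrC a) -scalerA -scalerDr; congr (_ *: _).
      by rewrite scalerBr opprD addrACA.
    rewrite rnormZr // -mulrA ler_wpM2l // (le_trans (ler_rnormB _ _)) //.
    have := qY x; have : q * rnorm x <= 1 * rnorm x.
      by rewrite ler_wpM2r ?rnorm_ge0 //; case/andP: q01 => _ /ltW.
    by lra.
  - by rewrite rdotZl rdotZr rdotBl rdotBr symY.
  - rewrite rdotZl mulr_ge0 // rdotBl subr_ge0 (le_trans (rdot_le _ _)) //.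
    rewrite -rnorm_sqr expr2 ler_wpM2r ?rnorm_ge0 // (le_trans (qY x)) //.
    by rewrite ler_piMl ?rnorm_ge0 //; case/andP: q01 => _ /ltW.
apply/funext => x /=.
have Y2 : Y (Y x) = Y x + Y x - A x.
  apply/(canRL (addrK _)); rewrite addrC.
  by rewrite {2 3}(YE x) -scalerDl -rmorphD -splitr scale1r.
rewrite (opZ _ _ lY) -scalerBr scalerA -rmorphM -expr2 sqr_sqrtr ?invr_ge0 ?ltW //.
rewrite (opB _ _ lY) Y2 /A.
have -> : x - Y x - (Y x - (Y x + Y x - (x - t%:C *: B x))) = t%:C *: B x.
  rewrite [- (Y x - _)]opprB -(addrA x) -!(addrA (Y x)) addKr (addrC (Y x)) subrK.
  by rewrite opprB addrC subrK.
by rewrite scalerA -rmorphM mulVf ?gt_eqF // scale1r.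
Qed.

End square_root.

(** * The Aluthge transform of a left-invertible operator *)

Section left_invertible.
Variables (R : realType) (H : hilbertType R).
Implicit Types (x y z : H) (B S T : H -> H).

Lemma bounded_linear T : bounded_operator T -> linear T.
Proof. by case. Qed.

Lemma rdot_adjoint T x y : bounded_operator T ->
  rdot (T x) y = rdot x (adjoint T y).
Proof. by move=> bT; rewrite /rdot (adjointP bT).2. Qed.

(** A left inverse bounded by [M] gives [|x| <= M |T x|], and
    [<T^* T x, x> = |T x|^2]. *)
Lemma gram_coercive T : bounded_operator T -> left_invertible T ->
  coercive (adjoint T \o T).
Proof.
move=> bT [L [bL LT]]; have [bT' _] := adjointP bT.
have [M M0 LM] := bounded_operatorE bL.
have gramE x y : rdot (adjoint T (T x)) y = rdot (T x) (T y).
  by rewrite rdotC -rdot_adjoint // rdotC.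
split.
  apply: positive_operatorI => [|x y|x] /=.
  - exact: bounded_operator_comp.
  - by rewrite gramE rdot_adjoint.
  - by rewrite gramE -rnorm_sqr sqr_ge0.
exists (M ^- 2) => [|x /=]; first by rewrite invr_gt0 exprn_gt0.
rewrite gramE -rnorm_sqr ler_pdivrMl ?exprn_gt0 // -exprMn.
rewrite ler_pXn2r ?nnegrE ?mulr_ge0 ?rnorm_ge0 ?(ltW M0) //.
by have := LM (T x); rewrite (congr1 (@^~ x) LT : L (T x) = x).
Qed.

(** Coercivity has to be shown for whichever positive square root [S] is
    selected. Positivity of [S] at [x - M^-1 S x] gives
    [|S x|^2 <= M <S x, x>], while [|S x|^2 = <B x, x>]. *)
Lemma coercive_sqrt_operator B : coercive B ->
  coercive (sqrt_operator B) /\ sqrt_operator B \o sqrt_operator B = B.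
Proof.
move=> cB; rewrite /sqrt_operator; case: xgetP => [S _ [posS SS]|noS]; last first.
  by have [S SP] := coercive_sqrt cB; case: (noS S).
split=> //; split=> //.
have [bS _] := posS; have symS := positive_operator_sym posS.
have [lS _] := bS.
have [M M0 SM] := bounded_operatorE bS; have [_ [c c0 cBx]] := cB.
exists (c / M) => [|x]; first by rewrite divr_gt0.
rewrite mulrAC ler_pdivrMr // (le_trans (cBx x)) // -SS /= symS -rnorm_sqr.
pose t := M^-1; have t0 : 0 < t by rewrite invr_gt0.
have tM : t * M = 1 by rewrite mulVf ?gt_eqF.
have := positive_operator_ge0 (x - t%:C *: S x) posS.
rewrite (opB _ _ lS) (opZ _ _ lS) rdotBl !rdotBr !rdotZl !rdotZr.
rewrite (symS (S x) x) -(rnorm_sqr (S x)).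
have : rdot (S (S x)) (S x) <= M * rnorm (S x) ^+ 2.
  by rewrite (le_trans (rdot_le _ _)) // expr2 mulrA ler_wpM2r ?rnorm_ge0.
set n := rnorm (S x) ^+ 2; set d := rdot (S (S x)) (S x).
set e := rdot (S x) x => dM h.
have td : t * (t * d) <= t * n.
  by rewrite ler_pM2l // -[leRHS]mul1r -tM -mulrA ler_pM2l.
have : M * (t * n) <= M * e by rewrite ler_pM2l //; lra.
by rewrite mulrA (mulrC M) tM mul1r mulrC.
Qed.

Section polar.
Variable T : H -> H.
Hypotheses (bT : bounded_operator T) (liT : left_invertible T).

Let coercive_abs : coercive (abs_operator T).
Proof. exact: (coercive_sqrt_operator (gram_coercive bT liT)).1. Qed.

Let linT : linear T. Proof. exact: bounded_linear. Qed.

Lemma left_invertible_inj : injective T.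
Proof.
have [L [_ LT]] := liT; apply: (can_inj (g := L)) => x.
exact: (congr1 (@^~ x) LT).
Qed.

(** Since [|T|] is invertible, the isometry [T |T|^-1] qualifies as the polar
    part, so the selection in [polar_part] succeeds. *)
Lemma polar_part_abs x : polar_part T (abs_operator T x) = T x.
Proof.
rewrite /polar_part; case: xgetP => [U _ [_ _ TU]|noU].
  by rewrite {2}TU.
exfalso; set Q := abs_operator T in noU *.
have [_ QQ] := coercive_sqrt_operator (gram_coercive bT liT).
have symQ : rsymmetric Q by apply: positive_operator_sym; case: coercive_abs.
have [bV [VQ QV]] := coercive_inverse coercive_abs.
set V := inverse_operator Q in bV VQ QV.
have QQx x' : Q (Q x') = adjoint T (T x') := congr1 (@^~ x') QQ.
have QVx y : Q (V y) = y := congr1 (@^~ y) QV.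
have VQx y : V (Q y) = y := congr1 (@^~ y) VQ.
have isoU y : rnorm (T (V y)) = rnorm y.
  apply/eqP; rewrite -(@eqrXn2 _ 2) ?rnorm_ge0 // !rnorm_sqr.
  by rewrite rdot_adjoint // -QQx -symQ QVx.
have bU : bounded_operator (T \o V) by exact: bounded_operator_comp.
have UQ : (T \o V) \o Q = T.
  by apply/funext => y /=; rewrite VQx.
apply: (noU (T \o V)); split=> //.
- by split=> // y _; rewrite normE /= isoU -normE.
- move=> y; split=> [/= Uy0|Ty0].
    suff -> : y = 0 by rewrite op0.
    by apply: rnorm_eq0; rewrite -isoU Uy0 rnorm0.
  have -> : y = 0 by apply: left_invertible_inj; rewrite Ty0 op0.
  by rewrite op0 //; case: bU.
Qed.

(** With [P := |T|^{1/2}], one has [P U P P = P U |T| = P T]. *)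
Lemma aluthge_similar : exists P P' : H -> H,
  [/\ bounded_operator P, bounded_operator P', is_inverse P P',
      bounded_operator (aluthge T)
    & forall x, aluthge T (P x) = P (T x)].
Proof.
have [cP PP] := coercive_sqrt_operator coercive_abs.
have [[bP _] _] := cP; have [bP' PP'] := coercive_inverse cP.
set P := sqrt_operator (abs_operator T) in cP PP bP bP' PP' *.
have aluthgeP x : aluthge T (P x) = P (T x).
  by rewrite -polar_part_abs -[abs_operator T x](congr1 (@^~ x) PP).
exists P, (inverse_operator P); split=> //.
have -> : aluthge T = P \o T \o inverse_operator P.
  apply/funext => x /=; rewrite -aluthgeP; congr (aluthge T _).
  by rewrite (congr1 (@^~ x) PP'.2 : P (inverse_operator P x) = x).
exact: bounded_operator_comp (bounded_operator_comp bP bT) bP'.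
Qed.

(** The last clause says that [T L_T] is the orthogonal projection onto the
    range of [T]: [h - T (L_T h)] lies in [ker T^*]. *)
Lemma shimorin_left_inverseP :
  [/\ bounded_operator (shimorin_left_inverse T),
      forall x, shimorin_left_inverse T (T x) = x
    & forall x, adjoint T (T (shimorin_left_inverse T x)) = adjoint T x].
Proof.
have [bV [VG GV]] := coercive_inverse (gram_coercive bT liT).
split.
- by apply: bounded_operator_comp => //; case: (adjointP bT).
- by move=> x; exact: (congr1 (fun f => f x) VG).
- by move=> x; exact: (congr1 (fun f => f (adjoint T x)) GV).
Qed.

End polar.

(** Two left inverses of [T] differ by an operator that vanishes on the range of
    [T], and here the complement [ker T^*] of the range is at most a line. *)
Theorem shimorin_aluthge_similar T (e : H) :
  bounded_operator T -> left_invertible T ->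
  (forall h, adjoint T h = 0 -> exists c : R[i], h = c *: e) ->
  exists X F : H -> H,
    [/\ bounded_invertible X, bounded_operator F, rank_le1 F
      & forall h, shimorin_left_inverse (aluthge T) (X h)
                  = X (shimorin_left_inverse T h + F h)].
Proof.
move=> bT liT kerT.
have [P [P' [bP bP' PP' bA AP]]] := aluthge_similar bT liT.
have P'P x : P' (P x) = x := congr1 (@^~ x) PP'.1.
have PP'x x : P (P' x) = x := congr1 (@^~ x) PP'.2.
have liA : left_invertible (aluthge T).
  have [L [bL LT]] := liT; exists (P \o L \o P'); split.
    exact: bounded_operator_comp (bounded_operator_comp bP bL) bP'.
  apply/funext => x /=.
  by rewrite -{1}(PP'x x) AP P'P (congr1 (@^~ (P' x)) LT : L (T (P' x)) = P' x) PP'x.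
have [bLT LT TLT] := shimorin_left_inverseP bT liT.
have [bLA LA _] := shimorin_left_inverseP bA liA.
pose F h := P' (shimorin_left_inverse (aluthge T) (P h)) - shimorin_left_inverse T h.
have bF : bounded_operator F.
  apply: bounded_operator_sub bLT.
  exact: bounded_operator_comp (bounded_operator_comp bP' bLA) bP.
have FT x : F (T x) = 0 by rewrite /F -AP LA P'P LT subrr.
exists P, F; split=> //.
- by split=> //; exists P'.
- have [lF _] := bF.
  exists (F e) => h; have [|c hc] := kerT (h - T (shimorin_left_inverse T h)).
    by rewrite (opB _ _ (bounded_linear (adjointP bT).1)) TLT subrr.
  by exists c; rewrite -(opZ _ _ lF) -hc (opB _ _ lF) FT subr0.
- by move=> h; rewrite /F addrC subrK PP'x.
Qed.

End left_invertible.

Theorem theorem7p5 (R : realType) (k : disc R -> disc R -> R[i])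
  (hk : analytic_kernel k) (H : rkhs k)
  (hpoly : forall p : {poly R[i]}, exists h : H, is_poly_function h p)
  (Mz : H -> H) (hMz : is_shift Mz) (hMz_bounded : bounded_operator Mz)
  (f : nat -> H)
  (hf_poly : forall n, exists p : {poly R[i]}, is_poly_function (f n) p)
  (hf_basis : orthonormal_basis f)
  (hMz_left : left_invertible Mz)
  (hker : forall h : H, adjoint Mz h = 0 <-> exists c : R[i], h = c *: f 0%N)
  (hf_span : forall n, (1 <= n)%N -> in_span_monomials_ge1 (f n)) :
  exists X F : H -> H,
    [/\ bounded_invertible X, bounded_operator F, rank_le1 F
      & forall h : H, shimorin_left_inverse (aluthge Mz) (X h)
                      = X (shimorin_left_inverse Mz h + F h)].
Proof.
exact: (shimorin_aluthge_similar hMz_bounded hMz_left (fun h => (hker h).1)).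
Qed.
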